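(* Let $r\ge1$. (i) The coloured permutation statistic $(\mathrm{des},\mathrm{comaj},\mathbf{col})$ (on $r$-coloured permutations) is shuffle compatible. (ii) The $\mathbb{Q}$-linear map $H:\mathcal A^{(r)}_{(\mathrm{des},\mathrm{comaj},\mathbf{col})}\to\mathbb{Q}[\bm p,x][[t\ast]]$ defined by $$[\bm a]\mapsto\frac{\bm p^{\mathbf{col}(\bm a)}x^{\mathrm{comaj}(\bm a)}t^{\mathrm{des}(\bm a)}}{(1-t)(1-xt)\cdots(1-x^{|\bm a|}t)}$$ is an injective $\mathbb{Q}$-algebra homomorphism.
   Context: Fix $r\ge1$. An $r$-coloured permutation is a word $\bm a=\sigma_1^{\gamma_1}\cdots\sigma_n^{\gamma_n}$ ($n\ge0$) with distinct positive integers $\sigma_i$ and colours $\gamma_i\in\{0,\dots,r-1\}$; $|\bm a|=n$. Coloured integers are ordered by $\sigma_1^{\gamma_1}<\sigma_2^{\gamma_2}$ iff either $\gamma_1=\gamma_2$ and $\sigma_1<\sigma_2$, or $\gamma_1>\gamma_2$ as integers. $\mathrm{Des}(\bm a)=\{i\in[n-1]:\sigma_i^{\gamma_i}>\sigma_{i+1}^{\gamma_{i+1}}\}$, with $0$ added if $n\ge1$ and $\gamma_1\ne0$; $\mathrm{des}(\bm a)=|\mathrm{Des}(\bm a)|$; $\mathrm{comaj}(\bm a)=\sum_{i\in\mathrm{Des}(\bm a)}(n-i)$; $\mathbf{col}(\bm a)=(\mathrm{col}_0(\bm a),\dots,\mathrm{col}_{r-1}(\bm a))$ with $\mathrm{col}_j(\bm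 a)=|\{i:\gamma_i=j\}|$. A coloured permutation statistic $\mathrm{st}$ (a function on coloured permutations depending only on the colours and the relative order of the symbols) is shuffle compatible if for all coloured permutations $\bm a,\bm b$ with disjoint symbol sets, the multiset $\{\!\{\mathrm{st}(\bm c):\bm c\text{ a shuffle of }\bm a,\bm b\}\!\}$ depends only on $\mathrm{st}(\bm a),\mathrm{st}(\bm b),|\bm a|,|\bm b|$. Then $\mathcal A^{(r)}_{\mathrm{st}}$ is the $\mathbb{Q}$-algebra with basis the classes $[\bm a]$ of $r$-coloured permutations under ''same length and same $\mathrm{st}$'', with product $[\bm a][\bm b]=\sum_{\bm c}[\bm c]$ over all shuffles $\bm c$ of symbol-disjoint representatives $\bm a,\bm b$. A tuple of statistics is the statistic $\bm a\mapsto(\mathrm{st}_1(\bm a),\dots,\mathrm{st}_k(\bm a))$. $p_0,\dots,p_{r-1},x,t$ are commuting indeterminates, $\bm p^{\bm v}=p_0^{v_0}\cdots p_{r-1}^{v_{r-1}}$, and for a ring $R$, $R[[t\ast]]$ denotes $R[[t]]$ with multiplication the Hadamard product in $t$: $\left(\sum a_mt^m\right)*\left(\sum b_mt^m\right)=\sum a_mb_mt^m$. *)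

(* Defs.v *)
From HB Require Import structures.
From mathcomp Require Import all_boot all_order all_algebra.
From mathcomp Require Import boolp.
From mathcomp Require Import mpoly finmap monalg.

Set Implicit Arguments.
Unset Strict Implicit.
Unset Printing Implicit Defensive.

Import GRing.Theory.
Local Open Scope ring_scope.
Local Open Scope quotient_scope.

(* The pair (s, g) is the coloured integer s^g. *)
Notation cint r := (nat * 'I_r)%type.

Definition clt r (x y : cint r) : bool :=
  ((x.2 == y.2) && (x.1 < y.1)%N) || (y.2 < x.2)%N.

Definition symbols r (w : seq (cint r)) : seq nat := [seq x.1 | x <- w].
Definition colours r (w : seq (cint r)) : seq 'I_r := [seq x.2 | x <- w].

Definition is_cperm r (w : seq (cint r)) : bool :=
  uniq (symbols w) && all (leq 1) (symbols w).

Record cperm (r : nat) : Type := CPerm {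
  cword :> seq (cint r);
  cwordP : is_cperm cword
}.

HB.instance Definition _ r := [isSub for @cword r].
HB.instance Definition _ r := [Countable of cperm r by <:].

(* Positions are numbered from 1, so that position i.+1 is [onth w i]. *)
Definition is_descent r (w : seq (cint r)) (i : nat) : bool :=
  match i with
  | 0 => if ohead w is Some x then x.2 != 0 :> nat else false
  | j.+1 =>
      if (onth w j, onth w j.+1) is (Some x, Some y) then clt y x else false
  end.

Definition Des r (w : seq (cint r)) : seq nat :=
  [seq i <- iota 0 (size w) | is_descent w i].

Definition des r (w : seq (cint r)) : nat := size (Des w).

Definition comaj r (w : seq (cint r)) : nat :=
  (\sum_(i <- Des w) (size w - i))%N.

Definition col r (w : seq (cint r)) : {ffun 'I_r -> nat} :=
  [ffun j => count_mem j (colours w)].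

Definition des_comaj_col r (a : cperm r) : nat * nat * {ffun 'I_r -> nat} :=
  (des a, comaj a, col a).

(* The list of all shuffles of two words, with multiplicity. *)
Fixpoint wshuffles (T : Type) (s : seq T) : seq T -> seq (seq T) :=
  if s is x :: s' then
    fix wshuffles_s t :=
      if t is y :: t' then
        map (cons x) (wshuffles s' t) ++ map (cons y) (wshuffles_s t')
      else [:: s]
  else fun t => [:: t].

Definition disjoint_symbols r (v w : seq (cint r)) : bool :=
  ~~ has (mem (symbols v)) (symbols w).

(* Only meant for symbol-disjoint arguments, in which case all the shuffles   *)
(* are coloured permutations (see [val_shuffles]).                            *)
Definition shuffles r (a b : cperm r) : seq (cperm r) :=
  pmap insub (wshuffles a b).

Definition same_relative_order r (a b : cperm r) : Prop :=
  size a = size b /\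
  forall i j, (i < size a)%N -> (j < size a)%N ->
    (nth 0 (symbols a) i < nth 0 (symbols a) j)%N =
    (nth 0 (symbols b) i < nth 0 (symbols b) j)%N.

Definition is_statistic r (T : Type) (st : cperm r -> T) : Prop :=
  forall a b : cperm r,
    colours a = colours b -> same_relative_order a b -> st a = st b.

(* Multisets are represented by lists up to [perm_eq]. *)
Definition shuffle_compatible r (T : eqType) (st : cperm r -> T) : Prop :=
  is_statistic st /\
  forall a b a' b' : cperm r,
    disjoint_symbols a b -> disjoint_symbols a' b' ->
    st a = st a' -> st b = st b' -> size a = size a' -> size b = size b' ->
    perm_eq [seq st c | c <- shuffles a b] [seq st c | c <- shuffles a' b'].

Section WordShuffles.
Variables (T : Type) (V : zmodType).
Implicit Types (s t u : seq T) (f : seq T -> V).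

Lemma wshuffles_cons x s y t :
  wshuffles (x :: s) (y :: t) =
  map (cons x) (wshuffles s (y :: t)) ++ map (cons y) (wshuffles (x :: s) t).
Proof. by []. Qed.

Lemma wshuffles0 s : wshuffles s [::] = [:: s].
Proof. by case: s. Qed.

Lemma sum_wshuffles_cons x s y t f :
  \sum_(w <- wshuffles (x :: s) (y :: t)) f w =
  \sum_(w <- wshuffles s (y :: t)) f (x :: w) +
  \sum_(w <- wshuffles (x :: s) t) f (y :: w).
Proof. by rewrite wshuffles_cons big_cat !big_map. Qed.

Lemma sum_wshufflesC s t f :
  \sum_(w <- wshuffles s t) f w = \sum_(w <- wshuffles t s) f w.
Proof.
elim: s t f => [|x s IHs] t f; first by rewrite wshuffles0.
elim: t f => [|y t IHt] f; first by rewrite wshuffles0.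
by rewrite !sum_wshuffles_cons IHs IHt addrC.
Qed.

Lemma sum_wshufflesA s t u f :
  \sum_(v <- wshuffles s t) \sum_(w <- wshuffles v u) f w =
  \sum_(v <- wshuffles t u) \sum_(w <- wshuffles s v) f w.
Proof.
elim: s t u f => [|x s IHs] t u f.
  by rewrite /= big_seq1; apply: eq_bigr => v _; rewrite big_seq1.
elim: t u f => [|y t IHt] u f; first by rewrite wshuffles0 /= !big_seq1.
elim: u f => [|z u IHu] f.
  rewrite wshuffles0 big_seq1.
  by apply: eq_bigr => v _; rewrite wshuffles0 big_seq1.
rewrite [LHS]sum_wshuffles_cons [RHS]sum_wshuffles_cons.
under eq_bigr do rewrite sum_wshuffles_cons.
under [X in _ + X = _]eq_bigr do rewrite sum_wshuffles_cons.
under [in RHS]eq_bigr do rewrite sum_wshuffles_cons.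
under [X in _ = _ + X]eq_bigr do rewrite sum_wshuffles_cons.
rewrite !big_split [LHS]addrACA.
rewrite -(sum_wshuffles_cons x s y t
  (fun v => \sum_(w <- wshuffles v u) f (z :: w))).
rewrite (IHs (y :: t) (z :: u)) (IHt (z :: u)) IHu.
rewrite [X in X + _ + _]sum_wshuffles_cons.
by rewrite -!addrA; congr (_ + _); rewrite addrCA.
Qed.

End WordShuffles.

Lemma mem_wshuffles (T : eqType) (s t w : seq T) :
  w \in wshuffles s t -> perm_eq w (s ++ t).
Proof.
elim: s t w => [|x s IHs] t w; first by rewrite inE => /eqP->.
elim: t w => [|y t IHt] w; first by rewrite inE cats0 => /eqP->.
rewrite wshuffles_cons mem_cat => /orP[] /mapP[v + ->].
  by move=> /IHs; rewrite /= perm_cons.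
move=> /IHt H; apply: (@perm_trans _ (y :: (x :: s) ++ t)).
  by rewrite perm_cons.
by rewrite -cat1s perm_catCA.
Qed.

Section Shuffles.
Variable r : nat.
Implicit Types (a b c : cperm r) (w : seq (cint r)).

Lemma disjoint_symbolsC w1 w2 :
  disjoint_symbols w1 w2 = disjoint_symbols w2 w1.
Proof. by rewrite /disjoint_symbols has_sym. Qed.

Lemma is_cperm_wshuffles a b w :
  disjoint_symbols a b -> w \in wshuffles a b -> is_cperm w.
Proof.
move=> dab /mem_wshuffles pw.
have ps : perm_eq (symbols w) (symbols a ++ symbols b).
  by rewrite -map_cat perm_map.
rewrite /is_cperm (perm_uniq ps) (perm_all _ ps) cat_uniq all_cat.
have /andP[-> ->] := cwordP a; have /andP[-> ->] := cwordP b.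
by rewrite [~~ _]dab.
Qed.

Lemma val_shuffles a b :
  disjoint_symbols a b -> [seq val c | c <- shuffles a b] = wshuffles a b.
Proof.
move=> dab; rewrite /shuffles.
have := @is_cperm_wshuffles a b ^~ dab.
elim: (wshuffles _ _) => //= w s IHs Hs.
rewrite insubT ?Hs ?mem_head //= => Pw; rewrite IHs // => v vs.
by apply: Hs; rewrite inE vs orbT.
Qed.

Lemma mem_shuffles a b c : c \in shuffles a b -> perm_eq c (a ++ b).
Proof. by rewrite mem_pmap_sub => /mem_wshuffles. Qed.

Lemma size_shuffles a b c :
  c \in shuffles a b -> size c = (size a + size b)%N.
Proof. by move=> /mem_shuffles/perm_size; rewrite size_cat. Qed.

Lemma disjoint_symbols_shuffles a b c d :
  c \in shuffles a b ->
  disjoint_symbols c d = disjoint_symbols a d && disjoint_symbols b d.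
Proof.
move=> /mem_shuffles pc; rewrite ![disjoint_symbols _ d]disjoint_symbolsC.
rewrite /disjoint_symbols.
have ps : perm_eq (symbols c) (symbols a ++ symbols b).
  by rewrite -map_cat perm_map.
by rewrite (perm_has _ ps) has_cat negb_or.
Qed.

Section Sums.
Variable V : zmodType.
Implicit Types f : cperm r -> V.

Let ext f w := if insub w is Some c then f c else 0.

Lemma sum_shuffles a b f : disjoint_symbols a b ->
  \sum_(c <- shuffles a b) f c = \sum_(w <- wshuffles a b) ext f w.
Proof.
move=> dab; rewrite -val_shuffles // big_map.
by apply: eq_bigr => c _; rewrite /ext valK.
Qed.

Lemma sum_shufflesC a b f : disjoint_symbols a b ->
  \sum_(c <- shuffles a b) f c = \sum_(c <- shuffles b a) f c.
Proof.
move=> dab; rewrite sum_shuffles // sum_shuffles; last by rewrite disjoint_symbolsC.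
exact: sum_wshufflesC.
Qed.

Lemma sum_shufflesA a b c f :
  disjoint_symbols a b -> disjoint_symbols a c -> disjoint_symbols b c ->
  \sum_(d <- shuffles a b) \sum_(e <- shuffles d c) f e =
  \sum_(d <- shuffles b c) \sum_(e <- shuffles a d) f e.
Proof.
move=> dab dac dbc.
transitivity (\sum_(v <- wshuffles a b) \sum_(w <- wshuffles v c) ext f w).
  rewrite -val_shuffles // big_map; apply: eq_big_seq => d dP.
  by rewrite sum_shuffles // (disjoint_symbols_shuffles _ dP) dac.
rewrite sum_wshufflesA -[X in \sum_(v <- X) _]val_shuffles // big_map.
apply: eq_big_seq => d dP; rewrite sum_shuffles //.
rewrite disjoint_symbolsC (disjoint_symbols_shuffles _ dP).
by rewrite ![disjoint_symbols _ a]disjoint_symbolsC dab.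
Qed.

End Sums.

Definition wshift (n : nat) w : seq (cint r) :=
  [seq ((x.1 + n)%N, x.2) | x <- w].

Lemma symbols_wshift n w : symbols (wshift n w) = map (addn^~ n) (symbols w).
Proof. by rewrite /symbols -!map_comp. Qed.

Lemma is_cperm_wshift n a : is_cperm (wshift n a).
Proof.
have /andP[ua pa] := cwordP a.
rewrite /is_cperm symbols_wshift map_inj_uniq ?ua; last exact: addIn.
rewrite all_map; apply/allP => s /(allP pa) /= s_gt0.
exact: leq_trans s_gt0 (leq_addr _ _).
Qed.

Definition shift n a : cperm r := CPerm (is_cperm_wshift n a).

Lemma size_shift n a : size (shift n a) = size a.
Proof. exact: size_map. Qed.

Lemma shift_statistic (T : Type) (st : cperm r -> T) n a :
  is_statistic st -> st (shift n a) = st a.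
Proof.
apply; first by rewrite /colours -map_comp.
split; rewrite ?size_shift // => i j ilt jlt.
rewrite /= symbols_wshift !(nth_map 0) ?size_map //.
by rewrite ltn_add2r.
Qed.

Definition symbol_bound a : nat := \max_(s <- symbols a) s.

Lemma leq_symbol_bound a s : s \in symbols a -> (s <= symbol_bound a)%N.
Proof. by move=> sa; rewrite /symbol_bound (big_rem s sa) leq_maxl. Qed.

Lemma disjoint_shift n a b :
  (symbol_bound a <= n)%N -> disjoint_symbols a (shift n b).
Proof.
move=> le_n; apply/hasPn => s /=; rewrite symbols_wshift => /mapP[u ub ->].
apply/negP => /leq_symbol_bound/leq_trans/(_ le_n).
have /andP[_ /allP/(_ u ub)] := cwordP b.
by rewrite addnC -{2}[n]addn0 leq_add2l leqn0 lt0n => /negPf->.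
Qed.

End Shuffles.

Section Classes.
Variables (r : nat) (T : eqType) (st : cperm r -> T).
Implicit Types a b c : cperm r.

Definition st_equiv : rel (cperm r) :=
  fun a b => (size a == size b) && (st a == st b).

Lemma st_equiv_refl : reflexive st_equiv.
Proof. by move=> a; rewrite /st_equiv !eqxx. Qed.

Lemma st_equiv_sym : ssrbool.symmetric st_equiv.
Proof.
by move=> a b; rewrite /st_equiv eq_sym [X in _ && X]eq_sym.
Qed.

Lemma st_equiv_trans : transitive st_equiv.
Proof. by move=> b a c /andP[/eqP sab /eqP tab]; rewrite /st_equiv sab tab. Qed.

Canonical st_equiv_rel :=
  EquivRel st_equiv st_equiv_refl st_equiv_sym st_equiv_trans.

Definition cclass : Type := {eq_quot st_equiv}.

HB.instance Definition _ := Choice.on cclass.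
HB.instance Definition _ := EqQuotient.on cclass.

Definition cclass_of a : cclass := \pi_cclass a.

Lemma cclass_of_eq a b : (cclass_of a == cclass_of b) = st_equiv a b.
Proof. exact: eqmodE. Qed.

Lemma size_repr a : size (repr (cclass_of a)) = size a.
Proof.
by apply/eqP; have := cclass_of_eq (repr (cclass_of a)) a;
  rewrite /cclass_of reprK eqxx => /esym/andP[].
Qed.

Lemma st_repr a : st (repr (cclass_of a)) = st a.
Proof.
by apply/eqP; have := cclass_of_eq (repr (cclass_of a)) a;
  rewrite /cclass_of reprK eqxx => /esym/andP[].
Qed.

End Classes.

(* The linear extension to the free module on K of a map K -> V. *)
Section Extension.
Variables (R : comNzRingType) (K : choiceType).
Implicit Types (u v : {malg R[K]}) (k : K).

Definition malg_ext (V : lmodType R) (h : K -> V) u : V :=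
  \sum_(k <- msupp u) mcoeff k u *: h k.

Section OneExt.
Variables (V : lmodType R).
Implicit Types h g : K -> V.

Lemma malg_extEw (d : {fset K}) h u : (msupp u `<=` d)%fset ->
  malg_ext h u = \sum_(k <- d) mcoeff k u *: h k.
Proof.
move=> le_d; rewrite /malg_ext (big_fset_incl _ le_d) //= => k _ /mcoeff_outdom ->.
by rewrite scale0r.
Qed.

Lemma malg_extU h k : malg_ext h << k >> = h k.
Proof.
by rewrite /malg_ext msuppU oner_eq0 big_seq_fset1 mcoeffUU scale1r.
Qed.

Lemma malg_ext_is_linear h : linear (malg_ext h).
Proof.
move=> x u v; pose d := (msupp u `|` msupp v)%fset.
rewrite (@malg_extEw d _ (x *: u + v)); last first.
  apply: fsubset_trans (msuppD_le _ _) _.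
  exact: fsetSU (msuppZ_le _ _).
rewrite (@malg_extEw d _ u) ?fsubsetUl // (@malg_extEw d _ v) ?fsubsetUr //.
rewrite scaler_sumr -big_split; apply: eq_bigr => k _ /=.
by rewrite mcoeffD mcoeffZ scalerDl scalerA.
Qed.

HB.instance Definition _ h :=
  GRing.isLinear.Build R {malg R[K]} V _ (malg_ext h) (malg_ext_is_linear h).

Lemma eq_malg_ext h g u : h =1 g -> malg_ext h u = malg_ext g u.
Proof. by move=> hg; apply: eq_bigr => k _; rewrite hg. Qed.

Lemma malg_ext_sum (I : Type) (s : seq I) (h : I -> K -> V) u :
  malg_ext (fun k => \sum_(i <- s) h i k) u = \sum_(i <- s) malg_ext (h i) u.
Proof.
rewrite [RHS]exchange_big; apply: eq_bigr => k _.
by rewrite scaler_sumr.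
Qed.

Lemma malg_extC (h : K -> K -> V) u v :
  malg_ext (fun k => malg_ext (h k) v) u =
  malg_ext (fun l => malg_ext (h^~ l) u) v.
Proof.
transitivity (\sum_(k <- msupp u) \sum_(l <- msupp v)
  (mcoeff k u * mcoeff l v) *: h k l).
  by apply: eq_bigr => k _; rewrite scaler_sumr; apply: eq_bigr => l _;
    rewrite scalerA.
rewrite exchange_big; apply: eq_bigr => l _; rewrite scaler_sumr.
by apply: eq_bigr => k _; rewrite scalerA mulrC.
Qed.

End OneExt.

Lemma malg_ext_id u : malg_ext (fun k => << k >>) u = u.
Proof.
rewrite [RHS]monalgE; apply: eq_bigr => k _.
by apply/malgP => l; rewrite mcoeffZ !mcoeffU mulr_natr.
Qed.

Lemma malg_ext_comp (V : lmodType R) (h : K -> V) (g : K -> {malg R[K]}) u :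
  malg_ext h (malg_ext g u) = malg_ext (fun k => malg_ext h (g k)) u.
Proof. by rewrite linear_sum; apply: eq_bigr => k _; rewrite linearZ. Qed.

End Extension.

Section ShuffleProduct.
Variables (r : nat) (T : eqType) (st : cperm r -> T).
Implicit Types (a b c : cperm r) (k l : cclass st).

Local Notation carrier := {malg rat[cclass st]}.
Local Notation cl := (cclass_of st).

(* [a] [b] is the sum of [c] over the shuffles c of a chosen pair of          *)
(* symbol-disjoint representatives, see [class_mulE].                         *)
Definition class_mul k l : carrier :=
  let a := repr k in
  let b := shift (symbol_bound a) (repr l) in
  \sum_(c <- shuffles a b) << cl c >>.

Definition shuffle_mul (u v : carrier) : carrier :=
  malg_ext (fun k => malg_ext (class_mul k) v) u.

Definition cperm0 : cperm r := @CPerm r [::] isT.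

Definition shuffle_one : carrier := << cl cperm0 >>.

Hypothesis sc : shuffle_compatible st.

Lemma perm_cclass n (s t : seq (cperm r)) :
  (forall c, c \in s -> size c = n) -> (forall c, c \in t -> size c = n) ->
  perm_eq (map st s) (map st t) -> perm_eq (map cl s) (map cl t).
Proof.
move=> sn tn pst; apply/allP => k _ /=; apply/eqP.
have cnt q : (forall c, c \in q -> size c = n) ->
    count_mem k (map cl q) =
    ((size (repr k) == n) * count_mem (st (repr k)) (map st q))%N.
  move=> qn; rewrite !count_map.
  transitivity (count (fun c => (size (repr k) == n) && (st c == st (repr k))) q).
    apply: eq_in_count => c /qn cn /=.
    by rewrite -[k in cl c == k]reprK cclass_of_eq /st_equiv cn eq_sym.
  case: eqP => _; rewrite ?mul1n ?mul0n //.
  by rewrite (eq_count (a2 := pred0)) ?count_pred0.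
by rewrite !cnt // (permP pst).
Qed.

Lemma class_mulE a b : disjoint_symbols a b ->
  class_mul (cl a) (cl b) = \sum_(c <- shuffles a b) << cl c >>.
Proof.
move=> dab; rewrite /class_mul /=.
set a' := repr _; set b' := shift _ _.
rewrite -(big_map cl predT (fun k => << k >> : carrier)).
rewrite -[RHS](big_map cl predT (fun k => << k >> : carrier)).
have sa : size a' = size a by rewrite size_repr.
have sb : size b' = size b by rewrite size_shift size_repr.
apply: perm_big; apply: (@perm_cclass (size a + size b)).
- by move=> c /size_shuffles->; rewrite sa sb.
- by move=> c /size_shuffles->.
case: sc => stat; apply => //.
- exact: disjoint_shift.
- exact: st_repr.
- by rewrite shift_statistic // st_repr.
Qed.

Lemma cclass_shift n a : cl (shift n a) = cl a.
Proof.
apply/eqP; rewrite cclass_of_eq /st_equiv size_shift eqxx.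
by rewrite shift_statistic ?eqxx //; case: sc.
Qed.

Lemma cclass_repr k : cl (repr k) = k.
Proof. exact: reprK. Qed.

Lemma class_mulC k l : class_mul k l = class_mul l k.
Proof.
rewrite -(cclass_repr k) -(cclass_repr l).
set a := repr k; rewrite -(cclass_shift (symbol_bound a) (repr l)).
set b := shift _ _; have dab : disjoint_symbols a b by apply: disjoint_shift.
rewrite (class_mulE dab) class_mulE; last by rewrite disjoint_symbolsC.
exact: sum_shufflesC.
Qed.

Lemma class_mulA k l m :
  malg_ext (class_mul k) (class_mul l m) =
  malg_ext (class_mul^~ m) (class_mul k l).
Proof.
rewrite -(cclass_repr k) -(cclass_repr l) -(cclass_repr m).
set a := repr k; rewrite -(cclass_shift (symbol_bound a) (repr l)).
set b := shift _ _; pose N := maxn (symbol_bound a) (symbol_bound b).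
rewrite -(cclass_shift N (repr m)); set c := shift N _.
have dab : disjoint_symbols a b by apply: disjoint_shift.
have dac : disjoint_symbols a c by apply/disjoint_shift/leq_maxl.
have dbc : disjoint_symbols b c by apply/disjoint_shift/leq_maxr.
rewrite (class_mulE dbc) (class_mulE dab) !linear_sum.
transitivity (\sum_(d <- shuffles b c) \sum_(e <- shuffles a d) << cl e >>
              : carrier).
  apply: eq_big_seq => d dP; rewrite [LHS]malg_extU class_mulE //.
  rewrite disjoint_symbolsC (disjoint_symbols_shuffles _ dP).
  by rewrite disjoint_symbolsC dab disjoint_symbolsC.
rewrite -sum_shufflesA //; apply: eq_big_seq => d dP.
by rewrite [RHS]malg_extU class_mulE // (disjoint_symbols_shuffles _ dP) dac.
Qed.

Lemma class_mul1 k : class_mul (cl cperm0) k = << k >>.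
Proof.
rewrite -(cclass_repr k) class_mulE; last by apply/hasPn.
by rewrite /shuffles /= valK /= big_seq1.
Qed.

Lemma shuffle_mulA : associative shuffle_mul.
Proof.
move=> u v w; rewrite /shuffle_mul.
rewrite [RHS]malg_ext_comp; apply: eq_malg_ext => k.
rewrite [RHS]malg_ext_comp [LHS]malg_ext_comp; apply: eq_malg_ext => l.
rewrite [LHS]malg_ext_comp; transitivity
  (malg_ext (fun m => malg_ext (class_mul^~ m) (class_mul k l)) w).
  by apply: eq_malg_ext => m; apply: class_mulA.
exact: malg_extC.
Qed.

Lemma shuffle_mulC : commutative shuffle_mul.
Proof.
move=> u v; transitivity (malg_ext (fun l => malg_ext (class_mul^~ l) u) v).
  exact: malg_extC.
apply: eq_malg_ext => k; apply: eq_malg_ext => l; exact: class_mulC.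
Qed.

Lemma shuffle_mul1 : left_id shuffle_one shuffle_mul.
Proof.
move=> u; rewrite /shuffle_mul [LHS]malg_extU -[RHS]malg_ext_id.
by apply: eq_malg_ext => k; apply: class_mul1.
Qed.

Lemma shuffle_mulDl : left_distributive shuffle_mul +%R.
Proof. by move=> u v w; rewrite /shuffle_mul linearD. Qed.

Lemma shuffle_one_neq0 : shuffle_one != 0.
Proof. by rewrite monalgU_eq0 oner_eq0. Qed.

Lemma shuffle_scaleAl (x : rat) (u v : carrier) :
  x *: shuffle_mul u v = shuffle_mul (x *: u) v.
Proof. by rewrite /shuffle_mul linearZ. Qed.

End ShuffleProduct.

Definition shuffle_algebra r (T : eqType) (st : cperm r -> T)
  (sc : shuffle_compatible st) : Type := {malg rat[cclass st]}.

Section ShuffleAlgebra.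
Variables (r : nat) (T : eqType) (st : cperm r -> T).
Variable sc : shuffle_compatible st.

Local Notation A := (shuffle_algebra sc).

HB.instance Definition _ := GRing.Lmodule.copy A {malg rat[cclass st]}.
HB.instance Definition _ := GRing.Zmodule_isComNzRing.Build A
  (shuffle_mulA sc) (shuffle_mulC sc) (shuffle_mul1 sc)
  (@shuffle_mulDl _ _ st) (shuffle_one_neq0 st).
HB.instance Definition _ :=
  GRing.Lmodule_isLalgebra.Build rat A (@shuffle_scaleAl _ _ st).
HB.instance Definition _ := GRing.Lalgebra_isComAlgebra.Build rat A.

Definition shuffle_class (a : cperm r) : A := << cclass_of st a >>.

Lemma shuffle_classM (a b : cperm r) : disjoint_symbols a b ->
  shuffle_class a * shuffle_class b =
  \sum_(c <- shuffles a b) shuffle_class c.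
Proof.
by move=> dab; rewrite [LHS]malg_extU malg_extU class_mulE.
Qed.

End ShuffleAlgebra.

Definition fps (R : Type) : Type := nat -> R.

HB.instance Definition _ (R : choiceType) := Choice.copy (fps R) (nat -> R).

Section FpsZmodule.
Variable R : zmodType.
Implicit Types f g h : fps R.

Definition fps_zero : fps R := fun=> 0.
Definition fps_opp f : fps R := fun n => - f n.
Definition fps_add f g : fps R := fun n => f n + g n.

Lemma fps_addA : associative fps_add.
Proof. by move=> f g h; apply/funext => n; apply: addrA. Qed.

Lemma fps_addC : commutative fps_add.
Proof. by move=> f g; apply/funext => n; apply: addrC. Qed.

Lemma fps_add0 : left_id fps_zero fps_add.
Proof. by move=> f; apply/funext => n; apply: add0r. Qed.

Lemma fps_addN : left_inverse fps_zero fps_opp fps_add.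
Proof. by move=> f; apply/funext => n; apply: addNr. Qed.

HB.instance Definition _ :=
  GRing.isZmodule.Build (fps R) fps_addA fps_addC fps_add0 fps_addN.

End FpsZmodule.

Section FpsRing.
Variable R : comNzRingType.
Implicit Types f g h : fps R.

Definition fpsC (c : R) : fps R := fun n => if n == 0%N then c else 0.
Definition fpsX : fps R := fun n => (n == 1%N)%:R.
Definition fps_mul f g : fps R := fun n => \sum_(i < n.+1) f i * g (n - i)%N.

Let trunc n f : {poly R} := \poly_(i < n.+1) f i.

Let coef_trunc n f i : (i <= n)%N -> (trunc n f)`_i = f i.
Proof. by move=> le_in; rewrite coef_poly ltnS le_in. Qed.

Lemma fps_mul_trunc n f g i : (i <= n)%N ->
  fps_mul f g i = (trunc n f * trunc n g)`_i.
Proof.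
move=> le_in; rewrite coefM; apply: eq_bigr => j _.
rewrite !coef_trunc ?(leq_trans (leq_subr _ _)) //.
by apply: leq_trans le_in; rewrite -ltnS.
Qed.

Lemma fps_mulC : commutative fps_mul.
Proof.
by move=> f g; apply/funext => n; rewrite !(@fps_mul_trunc n) // mulrC.
Qed.

Lemma fps_mulA : associative fps_mul.
Proof.
move=> f g h; apply/funext => n.
transitivity (trunc n f * (trunc n g * trunc n h))`_n.
  rewrite coefM; apply: eq_bigr => i _; have le_in : (i <= n)%N by case: i.
  by rewrite coef_trunc // (@fps_mul_trunc n) ?leq_subr.
rewrite mulrA coefM; apply: eq_bigr => i _; have le_in : (i <= n)%N by case: i.
by rewrite (@fps_mul_trunc n) // coef_trunc ?leq_subr.
Qed.

Lemma fps_mul1 : left_id (fpsC 1) fps_mul.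
Proof.
move=> f; apply/funext => n; rewrite /fps_mul big_ord_recl subn0 mul1r.
by rewrite big1 ?addr0 // => i _; rewrite mul0r.
Qed.

Lemma fps_mulDl : left_distributive fps_mul +%R.
Proof.
move=> f g h; apply/funext => n; rewrite [RHS]/GRing.add /= /fps_add -big_split.
by apply: eq_bigr => i _; apply: mulrDl.
Qed.

Lemma fpsC1_neq0 : fpsC 1 != 0.
Proof.
by apply/eqP => /(congr1 (fun f : fps R => f 0%N))/eqP; rewrite oner_eq0.
Qed.

HB.instance Definition _ := GRing.Zmodule_isComNzRing.Build (fps R)
  fps_mulA fps_mulC fps_mul1 fps_mulDl fpsC1_neq0.

Definition fps_unit : {pred fps R} := fun f => `[< exists g, g * f = 1 >].

Definition fps_inv f : fps R :=
  if pselect (exists g, g * f = 1) is left ex_g then projT1 (cid ex_g) else f.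

Lemma fps_mulV : {in fps_unit, left_inverse 1 fps_inv *%R}.
Proof.
move=> f /asboolP ex_g; rewrite /fps_inv.
by case: pselect => // ex_g'; case: cid.
Qed.

Lemma fps_unitP f g : g * f = 1 -> fps_unit f.
Proof. by move=> gf; apply/asboolP; exists g. Qed.

Lemma fps_inv_out : {in [predC fps_unit], fps_inv =1 id}.
Proof.
move=> f; rewrite !inE => /asboolPn nex_g; rewrite /fps_inv.
by case: pselect.
Qed.

HB.instance Definition _ := GRing.ComNzRing_hasMulInverse.Build (fps R)
  fps_mulV fps_unitP fps_inv_out.

(* 1 - c t is invertible, so that the quotients below are genuine.            *)
Lemma fps_geometric c :
  ((fun n => c ^+ n) : fps R) * (1 - fpsC c * fpsX) = 1.
Proof.
apply/funext => n; rewrite mulrBr mulr1.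
pose G : fps R := fun n => c ^+ n.
have mulX f m : (f * fpsX) m = if m is m'.+1 then f m' else 0.
  rewrite [LHS]/(fps_mul f fpsX m) /fps_mul; case: m => [|m].
    by rewrite big_ord1 mulr0.
  rewrite big_ord_recr big_ord_recr /= subnn subSnn mulr0 addr0 mulr1.
  rewrite big1 ?add0r // => i _; rewrite /fpsX.
  by rewrite subSn 1?ltnW // eqSS subn_eq0 leqNgt ltn_ord mulr0.
have mulC m : (fpsC c * G) m = c * G m.
  rewrite [LHS]/(fps_mul (fpsC c) G m) /fps_mul big_ord_recl subn0.
  by rewrite big1 ?addr0 // => i _; rewrite mul0r.
rewrite -/G mulrA [G * _]mulrC.
rewrite [LHS]/(G n - (fpsC c * G * fpsX) n) mulX.
case: n => [|n]; first exact: subr0.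
transitivity (G n.+1 - c * G n); last by rewrite /G exprS subrr.
by congr (_ - _); apply: mulC.
Qed.

Lemma fps_geometric_unit c : 1 - fpsC c * fpsX \is a GRing.unit.
Proof. exact: fps_unitP (fps_geometric c). Qed.

End FpsRing.

Definition hadamard (R : Type) : Type := nat -> R.

Definition to_hadamard (R : Type) (f : fps R) : hadamard R := f.

HB.instance Definition _ (R : zmodType) :=
  GRing.Zmodule.copy (hadamard R) (fps R).

Section HadamardRing.
Variable R : comNzRingType.
Implicit Types f g h : hadamard R.

Definition hadamard_one : hadamard R := fun=> 1.
Definition hadamard_mul f g : hadamard R := fun n => f n * g n.

Lemma hadamard_mulA : associative hadamard_mul.
Proof. by move=> f g h; apply/funext => n; apply: mulrA. Qed.

Lemma hadamard_mulC : commutative hadamard_mul.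
Proof. by move=> f g; apply/funext => n; apply: mulrC. Qed.

Lemma hadamard_mul1 : left_id hadamard_one hadamard_mul.
Proof. by move=> f; apply/funext => n; apply: mul1r. Qed.

Lemma hadamard_mulDl : left_distributive hadamard_mul +%R.
Proof. by move=> f g h; apply/funext => n; apply: mulrDl. Qed.

Lemma hadamard_one_neq0 : hadamard_one != 0.
Proof.
by apply/eqP => /(congr1 (fun f : hadamard R => f 0%N))/eqP; rewrite oner_eq0.
Qed.

HB.instance Definition _ := GRing.Zmodule_isComNzRing.Build (hadamard R)
  hadamard_mulA hadamard_mulC hadamard_mul1 hadamard_mulDl hadamard_one_neq0.

End HadamardRing.

Section HadamardAlgebra.
Variables (K : comNzRingType) (R : comAlgType K).
Implicit Types f g : hadamard R.

Definition hadamard_scale (x : K) f : hadamard R := fun n => x *: f n.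

Lemma hadamard_scaleA x y f :
  hadamard_scale x (hadamard_scale y f) = hadamard_scale (x * y) f.
Proof. by apply/funext => n; apply: scalerA. Qed.

Lemma hadamard_scale1 : left_id 1 hadamard_scale.
Proof. by move=> f; apply/funext => n; apply: scale1r. Qed.

Lemma hadamard_scaleDr : right_distributive hadamard_scale +%R.
Proof. by move=> x f g; apply/funext => n; apply: scalerDr. Qed.

Lemma hadamard_scaleDl f : {morph hadamard_scale^~ f : x y / x + y}.
Proof. by move=> x y; apply/funext => n; apply: scalerDl. Qed.

HB.instance Definition _ := GRing.Zmodule_isLmodule.Build K (hadamard R)
  hadamard_scaleA hadamard_scale1 hadamard_scaleDr hadamard_scaleDl.

Lemma hadamard_scaleAl x f g : x *: (f * g) = (x *: f) * g.
Proof. by apply/funext => n; apply: scalerAl. Qed.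

HB.instance Definition _ :=
  GRing.Lmodule_isLalgebra.Build K (hadamard R) hadamard_scaleAl.
HB.instance Definition _ :=
  GRing.Lalgebra_isComAlgebra.Build K (hadamard R).

End HadamardAlgebra.

(* Q[p_0, ..., p_(r-1), x]: the last variable is x. *)
Notation Qpx r := {mpoly rat[r.+1]}.

Definition pvar r (j : 'I_r) : Qpx r := 'X_(widen_ord (leqnSn r) j).
Definition xvar r : Qpx r := 'X_ord_max.

Definition pcol r (a : cperm r) : Qpx r := \prod_(j < r) pvar j ^+ col a j.

Definition genfun r (a : cperm r) : fps (Qpx r) :=
  fpsC (pcol a * xvar r ^+ comaj a) * fpsX _ ^+ des a /
  \prod_(i < (size a).+1) (1 - fpsC (xvar r ^+ i) * fpsX _).

(* Main.v *)
(* The coefficient of t^m in the image of [a] is p^col(a) times the generating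
   function, by x^(f_1 + ... + f_n), of the sequences 0 <= f_1 <= ... <= f_n <= m
   that increase strictly at the descents of a, with f_1 > 0 when 0 is a descent.
   Cutting a into the blocks on which f is constant writes it as a convolution,
   with respect to deconcatenation, of the functionals "w is increasing" weighted
   by x^(k|w|), k = 0, ..., m. Each of these is multiplicative for shuffles, and
   deconcatenation is a morphism for the shuffle product, so the convolution is
   multiplicative too. Linear independence of the images is triangularity in des,
   and it implies shuffle compatibility: the sum of the images over the shuffles
   of a and b is the product of the images of a and b. *)
From HB Require Import structures.
Require Import Defs.
From mathcomp Require Import all_boot all_order all_algebra.
From mathcomp Require Import boolp.
From mathcomp Require Import mpoly finmap monalg.
From mathcomp Require Import ring.

Set Implicit Arguments.
Unset Strict Implicit.
Unset Printing Implicit Defensive.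

Import GRing.Theory.
Local Open Scope ring_scope.

(** * Deconcatenation, convolution and shuffles *)

Section Convolution.
Variables (T : eqType) (R : comNzRingType).
Implicit Types (s t w : seq T) (f g : seq T -> R).

Definition conv f g w : R :=
  \sum_(i < (size w).+1) f (take i w) * g (drop i w).

Lemma conv_cons f g x w :
  conv f g (x :: w) = f [::] * g (x :: w) + conv (fun u => f (x :: u)) g w.
Proof. by rewrite /conv big_ord_recl. Qed.

Definition shuffle_sum f s t : R := \sum_(w <- wshuffles s t) f w.

Lemma shuffle_sum_cons f x s y t :
  shuffle_sum f (x :: s) (y :: t) =
  shuffle_sum (fun u => f (x :: u)) s (y :: t) +
  shuffle_sum (fun u => f (y :: u)) (x :: s) t.
Proof. exact: sum_wshuffles_cons. Qed.

Lemma shuffle_sum0s f t : shuffle_sum f [::] t = f t.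
Proof. exact: big_seq1. Qed.

Lemma shuffle_sums0 f s : shuffle_sum f s [::] = f s.
Proof. by rewrite /shuffle_sum wshuffles0 big_seq1. Qed.

(* Deconcatenation is a morphism for the shuffle product. *)
Lemma shuffle_sum_conv f g s t :
  shuffle_sum (conv f g) s t =
  \sum_(i < (size s).+1) \sum_(j < (size t).+1)
    shuffle_sum f (take i s) (take j t) * shuffle_sum g (drop i s) (drop j t).
Proof.
elim: s t f => [|x s IHs] t f.
  rewrite shuffle_sum0s big_ord1; apply: eq_bigr => j _.
  by rewrite !shuffle_sum0s.
elim: t f => [|y t IHt] f.
  rewrite shuffle_sums0; apply: eq_bigr => i _.
  by rewrite big_ord1 !shuffle_sums0.
rewrite shuffle_sum_cons.
have shC u s' t' : shuffle_sum (fun v => conv f g (u :: v)) s' t' =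
    f [::] * shuffle_sum (fun v => g (u :: v)) s' t' +
    shuffle_sum (conv (fun v => f (u :: v)) g) s' t'.
  rewrite /shuffle_sum big_distrr -big_split; apply: eq_bigr => v _.
  exact: conv_cons.
(* The cuts with empty prefix recombine into the $(0,0)$ term; the remaining terms are matched
   according to whether $i$ and $j$ vanish. *)
rewrite !shC addrACA -mulrDr -shuffle_sum_cons IHs IHt /=.
rewrite [X in _ + (X + _)](_ : _ = \sum_(i < (size s).+1)
    (shuffle_sum (fun u => f (x :: u)) (take i s) [::] *
       shuffle_sum g (drop i s) (y :: t) +
     \sum_(j < (size t).+1)
      shuffle_sum (fun u => f (x :: u)) (take i s) (y :: take j t) *
      shuffle_sum g (drop i s) (drop j t))); last first.
  by apply: eq_bigr => i _; rewrite big_ord_recl.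
rewrite big_split [X in _ + (_ + X)]big_ord_recl.
rewrite [RHS]big_ord_recl [X in _ = X + _]big_ord_recl.
under [X in _ = _ + X]eq_bigr => i _ do rewrite big_ord_recl.
rewrite [X in _ = _ + X]big_split /= shuffle_sum0s !addrA.
rewrite [X in X + _ = _]addrAC -[LHS]addrA.
rewrite [X in X + _ = _]addrAC; congr (_ + _ + _ + _).
- by apply: eq_bigr => j _; rewrite !shuffle_sum0s.
- by apply: eq_bigr => i _; rewrite !shuffle_sums0.
rewrite -big_split; apply: eq_bigr => i _; rewrite -big_split.
by apply: eq_bigr => j _; rewrite /= shuffle_sum_cons mulrDl.
Qed.

Definition shuffle_multiplicative f :=
  forall s t, ~~ has (mem s) t -> shuffle_sum f s t = f s * f t.

(** By [shuffle_sum_conv] both sides are sums over pairs of cuts, and prefixes and suffixes of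
    disjoint words are again disjoint. *)
Lemma conv_multiplicative f g :
  shuffle_multiplicative f -> shuffle_multiplicative g ->
  shuffle_multiplicative (conv f g).
Proof.
move=> fM gM s t /hasPn dst; rewrite shuffle_sum_conv big_distrlr /=.
apply: eq_bigr => i _; apply: eq_bigr => j _.
have dd u v : {subset u <= s} -> {subset v <= t} -> ~~ has (mem u) v.
  move=> us vt; apply/hasPn => y /vt/dst; exact/contra/us.
rewrite (fM (take i s)) ?(gM (drop i s)); first exact: mulrACA.
  by apply: dd => y; apply: mem_drop.
by apply: dd => y; apply: mem_take.
Qed.

End Convolution.

(** * Generating functions of bounded P-partitions of a word *)

Section PPartitions.
Variables (T : eqType) (lt : rel T) (z0 : T) (R : comNzRingType) (x : R).
Hypothesis lt_trans : transitive lt.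
Hypothesis lt_asym : forall y z, lt y z -> ~~ lt z y.
Hypothesis lt_total : forall y z, y != z -> lt y z || lt z y.
Implicit Types (s t w : seq T).

Let disjoint_cons (y : T) s z t : ~~ has (mem (y :: s)) (z :: t) ->
  [/\ y != z, ~~ has (mem s) (z :: t) & ~~ has (mem (y :: s)) t].
Proof.
move=> /hasPn dst; split.
- by have := dst z (mem_head _ _); rewrite inE negb_or eq_sym => /andP[].
- apply/hasPn => u /dst; rewrite inE negb_or => /andP[] //.
- by apply/hasPn => u ut; apply: dst; rewrite inE ut orbT.
Qed.

(** Two increasing words without common letter have exactly one increasing shuffle, their merge; if
    either word is not increasing, no shuffle is. *)
Lemma path_multiplicative z :
  shuffle_multiplicative (fun w => (path lt z w)%:R : R).
Proof.
move=> s; elim: s z => [|y s IHs] z t; first by rewrite shuffle_sum0s mul1r.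
elim: t z => [|u t IHt] z; first by rewrite shuffle_sums0 mulr1.
move=> /disjoint_cons[yu ds dt]; rewrite shuffle_sum_cons /=.
have push v s' t' : shuffle_sum (fun w => (lt z v && path lt v w)%:R : R) s' t' =
    (lt z v)%:R * shuffle_sum (fun w => (path lt v w)%:R) s' t'.
  rewrite /shuffle_sum big_distrr; apply: eq_bigr => w _ /=.
  by rewrite -natrM mulnb.
rewrite !push IHs // IHt //= -!natrM -!natrD !mulnb; congr (_%:R).
(* Only the smaller head can come first; that [z] lies below the other head then follows by
   transitivity. *)
have := lt_total yu; case yu1: (lt y u); case uy1: (lt u y) => //= _.
- by have := lt_asym yu1; rewrite uy1.
- rewrite !andbF addn0; case zy: (lt z y) => //=.
  by rewrite (lt_trans zy yu1).
- rewrite !andbF; case zu: (lt z u); rewrite //= ?andbF //.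
  by rewrite (lt_trans zu uy1).
Qed.

Lemma sorted_multiplicative :
  shuffle_multiplicative (fun w => (sorted lt w)%:R : R).
Proof.
move=> [|y s] [|u t]; rewrite ?shuffle_sum0s ?shuffle_sums0 ?mul1r ?mulr1 //.
move=> /disjoint_cons[yu ds dt]; rewrite shuffle_sum_cons /=.
rewrite !path_multiplicative //= -!natrM -!natrD !mulnb; congr (_%:R).
have := lt_total yu; case yu1: (lt y u); case uy1: (lt u y) => //= _.
- by have := lt_asym yu1; rewrite uy1.
- by rewrite addn0.
- by rewrite andbF.
Qed.

Definition weight m w : R := (sorted lt w)%:R * x ^+ (m * size w).

Lemma weight_multiplicative m : shuffle_multiplicative (weight m).
Proof.
move=> s t dst; rewrite /weight mulrACA -exprD -mulnDr -sorted_multiplicative //.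
rewrite /shuffle_sum big_distrl; apply: eq_big_seq => w /mem_wshuffles/perm_size.
by rewrite size_cat => ->.
Qed.

(* [weight k] accounts for the block on which f = k; the block on which f = 0 *)
(* must also increase from [z0].                                              *)
Fixpoint ppart m : seq T -> R :=
  if m is m'.+1 then conv (ppart m') (weight m)
  else fun w => (path lt z0 w)%:R.

Lemma ppart_multiplicative m : shuffle_multiplicative (ppart m).
Proof.
elim: m => [|m IHm]; first exact: path_multiplicative.
by apply: conv_multiplicative => //; apply: weight_multiplicative.
Qed.

Lemma weight0 m : weight m [::] = 1.
Proof. by rewrite /weight muln0 mulr1. Qed.

Lemma ppart0 m : ppart m [::] = 1.
Proof. by elim: m => //= m IHm; rewrite /conv big_ord1 IHm weight0 mulr1. Qed.

Lemma ppart0_rcons w z :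
  ppart 0 (rcons w z) = if lt (last z0 w) z then ppart 0 w else 0.
Proof. by rewrite /= rcons_path; case: lt; rewrite ?andbT ?andbF. Qed.

(** The last value is either at most $m$, or equal to $m+1$ with weight $x^{m+1}$. In the latter
    case the values on [w] are bounded by $m+1$ at an ascent and by $m$ at a descent. *)
Lemma ppartS_rcons m w z :
  ppart m.+1 (rcons w z) = ppart m (rcons w z) +
    x ^+ m.+1 * (if lt (last z0 w) z then ppart m.+1 w else ppart m w).
Proof.
rewrite /= {1}/conv size_rcons big_ord_recr /=.
rewrite take_oversize ?size_rcons // drop_oversize ?size_rcons //.
rewrite weight0 mulr1 addrC; congr (_ + _).
rewrite /conv !big_ord_recr /= drop_size take_size weight0 mulr1.
rewrite drop_rcons // drop_size -cats1 take_size_cat // cats1.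
rewrite {2}/weight /= mul1r muln1.
(* The block consisting of [z] alone contributes in both cases; only longer last blocks require an
   ascent. *)
have -> (b : bool) (u v : R) : (if b then u + v else v) = u *+ b + v.
  by case: b; rewrite ?add0r.
rewrite mulrDr [_ * ppart m w]mulrC; congr (_ + _).
rewrite -sumrMnl big_distrr /=; apply: eq_bigr => i _.
have lei : (i <= size w)%N := ltnW (ltn_ord i).
rewrite drop_rcons // -cats1 takel_cat //.
(* As [i < size w], the block without [z] is nonempty and ends with the last letter of [w], so
   appending [z] tests precisely the ascent. *)
have := congr1 (last z0) (cat_take_drop i w); rewrite last_cat => <-.
case: drop (size_drop i w) (ltn_ord i) => [/esym/eqP|y v _ _].
  by rewrite subn_eq0 leqNgt => /negPf->.
rewrite /weight /= rcons_path size_rcons [(_ * (size v).+2)%N]mulnS exprD.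
rewrite -mulnb natrM -mulr_natr; ring.
Qed.

End PPartitions.

(** * Power series, dilation and the denominators *)

Section PowerSeries.
Variable R : comNzRingType.
Implicit Types f g : fps R.

Lemma fpsME f g n : (f * g) n = \sum_(i < n.+1) f i * g (n - i)%N.
Proof. by []. Qed.

Lemma fpsMX f n : (f * fpsX R) n = if n is n'.+1 then f n' else 0.
Proof.
rewrite fpsME; case: n => [|n]; first by rewrite big_ord1 mulr0.
rewrite big_ord_recr big_ord_recr /= subnn subSnn mulr0 addr0 mulr1.
rewrite big1 ?add0r // => i _; rewrite /fpsX.
by rewrite subSn 1?ltnW // eqSS subn_eq0 leqNgt ltn_ord mulr0.
Qed.

Lemma fpsCM c f n : (fpsC c * f) n = c * f n.
Proof.
rewrite fpsME big_ord_recl subn0 big1 ?addr0 // => i _; exact: mul0r.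
Qed.

Lemma fpsMXn f d n : (f * fpsX R ^+ d) n = if (n < d)%N then 0 else f (n - d)%N.
Proof.
elim: d n => [|d IHd] [|n]; rewrite ?mulr1 ?subn0 //.
  by rewrite exprSr mulrA fpsMX.
by rewrite exprSr mulrA fpsMX IHd.
Qed.

Lemma fpsC1 : fpsC 1 = 1 :> fps R.
Proof. by []. Qed.

Lemma fpsC_mul (c d : R) : fpsC (c * d) = fpsC c * fpsC d.
Proof.
by apply/funext => m; rewrite fpsCM /fpsC; case: eqP; rewrite ?mulr0.
Qed.

Lemma fpsC_exp (c : R) n : fpsC (c ^+ n) = fpsC c ^+ n.
Proof. by elim: n => // n IHn; rewrite !exprS fpsC_mul IHn. Qed.

Lemma fpsM0 f g : (f * g) 0%N = f 0%N * g 0%N.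
Proof. exact: big_ord1. Qed.

(** The substitution $t\mapsto xt$; as a ring morphism it acts on closed forms factor by factor. *)
Definition fps_dilate (x : R) f : fps R := fun n => x ^+ n * f n.

Lemma fps_dilate_is_zmod_morphism x : zmod_morphism (fps_dilate x).
Proof. by move=> f g; apply/funext => n; apply: mulrBr. Qed.

Lemma fps_dilate_is_monoid_morphism x : monoid_morphism (fps_dilate x).
Proof.
split=> [|f g]; apply/funext => n.
  by case: n => [|n]; rewrite /fps_dilate ?mul1r // mulr0.
rewrite /fps_dilate !fpsME big_distrr; apply: eq_bigr => i _ /=.
by rewrite mulrACA -exprD subnKC // -ltnS.
Qed.

HB.instance Definition _ x := GRing.isZmodMorphism.Build (fps R) (fps R)
  (fps_dilate x) (fps_dilate_is_zmod_morphism x).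
HB.instance Definition _ x := GRing.isMonoidMorphism.Build (fps R) (fps R)
  (fps_dilate x) (fps_dilate_is_monoid_morphism x).

Lemma fps_dilateC x c : fps_dilate x (fpsC c) = fpsC c.
Proof.
by apply/funext => -[|n]; rewrite /fps_dilate /fpsC ?mul1r //= mulr0.
Qed.

Lemma fps_dilateX x : fps_dilate x (fpsX R) = fpsC x * fpsX R.
Proof.
apply/funext => n; rewrite fpsCM /fps_dilate /fpsX.
by case: n => [|[|n]]; rewrite ?mulr0 // expr1.
Qed.

(** The $q$-Pochhammer symbol $(t;x)_{n+1}$. *)
Definition qfactor (x : R) n : fps R :=
  \prod_(i < n.+1) (1 - fpsC (x ^+ i) * fpsX R).

(** Dilation raises every exponent $i$ by one, leaving out only the factor $1-t$. *)
Lemma qfactorS x n :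
  qfactor x n.+1 = (1 - fpsX R) * fps_dilate x (qfactor x n).
Proof.
rewrite /qfactor big_ord_recl expr0 fpsC1 mul1r; congr (_ * _).
rewrite rmorph_prod; apply: eq_bigr => i _.
rewrite rmorphB rmorph1 rmorphM /= fps_dilateC fps_dilateX mulrA.
by rewrite !fpsC_exp -exprSr.
Qed.

Lemma qfactor_unit x n : qfactor x n \is a GRing.unit.
Proof. by apply: rpred_prod => i _; apply: fps_geometric_unit. Qed.

Lemma qfactor_inv0 x n : (qfactor x n)^-1 0%N = 1.
Proof.
have /(congr1 (fun f : fps R => f 0%N)) := mulVr (qfactor_unit x n).
rewrite fpsM0 [X in _ * X](_ : _ = 1) ?mulr1 // /qfactor.
elim/big_rec: _ => // i f _ f0; rewrite fpsM0 f0 mulr1.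
by rewrite -[LHS]/(1 - (fpsC (x ^+ i) * fpsX R) 0%N) fpsMX subr0.
Qed.

End PowerSeries.

Lemma onth_lt (T : Type) (x0 : T) s i :
  (i < size s)%N -> onth s i = Some (nth x0 s i).
Proof. by move=> lt_is; rewrite onthE (nth_map x0). Qed.

(** * Descents of coloured words and the closed form of the series *)

Section ColouredWords.
Variable r : nat.
Implicit Types (w : seq (cint r.+1)) (y z : cint r.+1).

Definition zero_letter : cint r.+1 := (0%N, ord0).

Lemma clt_trans : transitive (@clt r.+1).
Proof.
move=> [b h] [a g] [c k]; rewrite /clt /=.
case/orP=> [/andP[/eqP<- ab]|hg] /orP[/andP[/eqP kh bc]|kh].
- by rewrite kh eqxx (ltn_trans ab bc).
- by rewrite kh orbT.
- by rewrite -kh hg orbT.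
- by rewrite (ltn_trans kh hg) orbT.
Qed.

Lemma clt_asym y z : clt y z -> ~~ clt z y.
Proof.
rewrite /clt [z.2 == _]eq_sym; case: eqP => [->|_] /=.
  by rewrite ltnn orbF => /ltnW; rewrite orbF -leqNgt.
by move=> /ltnW; rewrite -leqNgt.
Qed.

Lemma clt_total y z : y != z -> clt y z || clt z y.
Proof.
case: y z => [a g] [b h]; rewrite xpair_eqE negb_and /clt /= [h == g]eq_sym.
rewrite -[g == h]val_eqE /=; case: (ltngtP g h) => //= _; rewrite ?orbT //.
by rewrite !orbF neq_ltn.
Qed.

Lemma is_cperm_rcons w z : is_cperm (rcons w z) -> is_cperm w.
Proof.
rewrite /is_cperm /symbols map_rcons rcons_uniq all_rcons.
by move=> /andP[/andP[_ ->] /andP[_ ->]].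
Qed.

Lemma uniq_cperm w : is_cperm w -> uniq w.
Proof. by case/andP => /map_uniq. Qed.

(* A zeroth letter [0^0] accounts for the descent at position 0. *)
Lemma is_descentE w i : is_cperm w -> (i < size w)%N ->
  is_descent w i = ~~ clt (nth zero_letter (zero_letter :: w) i)
                          (nth zero_letter w i).
Proof.
move=> cw; case: i => [|i] lt_iw.
  case: w cw lt_iw => //= z w /andP[_ /andP[z_gt0 _]] _.
  (* A first letter of colour 0 exceeds $0^0$ because its symbol is positive; any other colour puts
     it below. *)
  rewrite /clt /= -[ord0 == z.2]val_eqE z_gt0 andbT ltn0 orbF /=.
  by rewrite eq_sym.
rewrite /is_descent !(onth_lt zero_letter) ?(ltnW lt_iw) //=.
have := nth_uniq zero_letter lt_iw (ltnW lt_iw) (uniq_cperm cw).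
set z := nth _ _ _; set y := nth _ _ _; rewrite gtn_eqF // => /negbT.
by move=> /clt_total; case: (boolP (clt y z)) => [/clt_asym/negPf->|_ /orP[]].
Qed.

Lemma Des_rcons w z : is_cperm (rcons w z) ->
  Des (rcons w z) =
  Des w ++ (if clt (last zero_letter w) z then [::] else [:: size w]).
Proof.
move=> cwz; have cw := is_cperm_rcons cwz.
rewrite /Des size_rcons -(addn1 (size w)) iotaD filter_cat add0n /=.
rewrite is_descentE ?size_rcons // nth_rcons ltnn eqxx.
rewrite -rcons_cons nth_rcons ltnSn.
rewrite -/(nth zero_letter (zero_letter :: w) (size (zero_letter :: w)).-1).
rewrite nth_last.
congr (_ ++ _); last by case: clt.
apply: eq_in_filter => i; rewrite mem_iota add0n => /= lt_iw.
rewrite !is_descentE ?size_rcons ?(leqW lt_iw) // -rcons_cons !nth_rcons /=.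
by rewrite lt_iw (leqW lt_iw).
Qed.

Let ascent w z := clt (last zero_letter w) z.

Lemma des_rcons w z : is_cperm (rcons w z) ->
  des (rcons w z) = (des w + ~~ ascent w z)%N.
Proof.
by move=> cwz; rewrite /des Des_rcons // size_cat -/(ascent w z); case: ascent.
Qed.

(** Lengthening the word adds 1 to the contribution of each old descent, hence [des w] in all; a new
    descent contributes 1. *)
Lemma comaj_rcons w z : is_cperm (rcons w z) ->
  comaj (rcons w z) = (comaj w + des w + ~~ ascent w z)%N.
Proof.
move=> cwz; rewrite /comaj Des_rcons // big_cat -/(ascent w z) size_rcons /=.
congr (_ + _)%N; last first.
  by case: ascent; rewrite ?big_nil // big_seq1 subSnn.
rewrite -[X in (_ + X)%N]sum1_size -big_split; apply: eq_big_seq => i.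
rewrite mem_filter mem_iota add0n => /andP[_ /andP[_ lt_iw]] /=.
by rewrite subSn ?addn1 // ltnW.
Qed.

Section Series.
Variables (R : comNzRingType) (x : R).

Definition ppart_series w : fps R :=
  fun m => ppart (@clt r.+1) zero_letter x m w.

(** This is [ppartS_rcons] read on series: $1-t$ takes differences in $m$, the weight of the last
    letter becomes a dilation, and the bound lowered at a descent becomes the factor $xt$. *)
Lemma ppart_series_rcons w z :
  ppart_series (rcons w z) * (1 - fpsX R) =
  (fpsC x * fpsX R) ^+ (~~ ascent w z) * fps_dilate x (ppart_series w).
Proof.
apply/funext => m; rewrite mulrBr mulr1.
set f := ppart_series _; rewrite -[LHS]/(f m - (f * fpsX R) m) {}/f.
rewrite fpsMX -[LHS]/(ppart _ _ _ _ _ - _).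
case: m => [|m].
  rewrite subr0 ppart0_rcons -/(ascent w z).
  case: ascent; first by rewrite expr0 mul1r /fps_dilate mul1r.
  by rewrite expr1 -mulrA fpsCM [fpsX R * _]mulrC fpsMX mulr0.
rewrite ppartS_rcons addrAC subrr add0r -/(ascent w z).
case: ascent; first by rewrite expr0 mul1r.
by rewrite expr1 -mulrA fpsCM [fpsX R * _]mulrC fpsMX exprS -mulrA.
Qed.

(** By induction on the last letter: dilation turns $x^{comaj}t^{des}$ into $x^{comaj+des}t^{des}$
    and a descent adds $xt$, which is how [comaj] and [des] grow. *)
Lemma ppart_seriesM w : is_cperm w ->
  ppart_series w * qfactor x (size w) = fpsC (x ^+ comaj w) * fpsX R ^+ des w.
Proof.
elim/last_ind: w => [_|w z IHw cwz].
  rewrite /comaj /des /Des /= big_nil !expr0 mulr1 /qfactor big_ord1 expr0.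
  rewrite fpsC1 -[RHS](fps_geometric (1 : R)); congr (_ * _).
  by apply/funext => m; rewrite /ppart_series ppart0 expr1n.
rewrite size_rcons qfactorS mulrA ppart_series_rcons -mulrA -rmorphM.
rewrite IHw ?(is_cperm_rcons cwz) // rmorphM rmorphXn /= fps_dilateC fps_dilateX.
rewrite mulrCA -exprD comaj_rcons // des_rcons // exprMn -!fpsC_exp mulrA.
rewrite ![(_ + ~~ _)%N]addnC; congr (_ * _).
by rewrite !fpsC_exp -exprD addnA [(comaj w + _)%N]addnC addnA.
Qed.

End Series.
End ColouredWords.

(** * From a multiplicative, linearly independent family of series to the algebra morphism *)

Section HadamardMorphism.
Variables (r : nat) (T : eqType) (st : cperm r -> T) (R : comAlgType rat).
Variable g : cperm r -> fps R.
Implicit Types a b c : cperm r.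

Hypothesis eq_g : forall a b, size a = size b -> st a = st b -> g a = g b.
Hypothesis g_cperm0 : forall m, g (cperm0 r) m = 1.
Hypothesis g_shuffles : forall a b m, disjoint_symbols a b ->
  \sum_(c <- shuffles a b) g c m = g a m * g b m.
Hypothesis g_free : forall u : {malg rat[cclass st]},
  (forall m, \sum_(k <- msupp u) mcoeff k u *: g (repr k) m = 0) -> u = 0.

Let A := {malg rat[cclass st]}.

Lemma hadamard_sumE (I : Type) (s : seq I) (F : I -> hadamard R) m :
  (\sum_(i <- s) F i) m = \sum_(i <- s) F i m.
Proof. by elim: s => [|i s IHs]; rewrite ?big_nil // !big_cons -IHs. Qed.

Let gk (k : cclass st) : hadamard R := to_hadamard (g (repr k)).

Let gk_class a : gk (cclass_of st a) = to_hadamard (g a).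
Proof. by congr to_hadamard; apply: eq_g; rewrite ?size_repr ?st_repr. Qed.

Let malg_ext_inj : injective (malg_ext gk).
Proof.
apply: raddf_inj => u u0; apply: g_free => m.
rewrite -[RHS](congr1 (fun f : hadamard R => f m) u0).
exact/esym/hadamard_sumE.
Qed.

(** Phrased with the formal sum over shuffles, since the algebra structure is available only once
    shuffle compatibility is known. *)
Let malg_ext_shuffles a b : disjoint_symbols a b ->
  malg_ext gk (\sum_(c <- shuffles a b) << cclass_of st c >>) =
  to_hadamard (g a) * to_hadamard (g b).
Proof.
move=> dab; rewrite raddf_sum; apply/funext => m; rewrite hadamard_sumE.
rewrite -[RHS](g_shuffles m dab); apply: eq_bigr => c _.
by rewrite /= malg_extU gk_class.
Qed.

Let mcoeff_sum_class (s : seq (cperm r)) (k : cclass st) :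
  mcoeff k (\sum_(c <- s) << cclass_of st c >> : A) =
  (count_mem k [seq cclass_of st c | c <- s])%:R.
Proof.
rewrite raddf_sum /= -sum1_count big_map natr_sum [RHS]big_mkcond /=.
by apply: eq_bigr => c _; rewrite mcoeffU; case: eqP.
Qed.

(** The two formal sums over shuffles have the same image, so they coincide by injectivity of the
    linear extension. *)
Lemma shuffle_compatible_free : is_statistic st -> shuffle_compatible st.
Proof.
split=> // a b a' b' dab dab' eq_a eq_b size_a size_b.
have eq_sum : \sum_(c <- shuffles a b) << cclass_of st c >> =
    \sum_(c <- shuffles a' b') << cclass_of st c >> :> A.
  apply: malg_ext_inj; rewrite !malg_ext_shuffles //.
  by rewrite (eq_g size_a eq_a) (eq_g size_b eq_b).
have size_sh c : c \in shuffles a b ++ shuffles a' b' ->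
    size c = (size a + size b)%N.
  by rewrite mem_cat => /orP[]/size_shuffles->; rewrite ?size_a ?size_b.
apply/allP => t /=; rewrite -map_cat => /mapP[c /size_sh size_c ->].
(* All shuffles involved have the same length, so the value of [st] determines the class. *)
have cnt s : {subset s <= shuffles a b ++ shuffles a' b'} ->
    count_mem (st c) (map st s) =
    count_mem (cclass_of st c) (map (cclass_of st) s).
  move=> sub_s; rewrite !count_map.
  apply: eq_in_count => d /sub_s/size_sh size_d.
  by rewrite /= cclass_of_eq /st_equiv size_c size_d eqxx.
rewrite !cnt => [|d|d]; try by rewrite mem_cat => ->; rewrite ?orbT.
(* Multiplicities are read off as rational coefficients, faithfully in characteristic zero. *)
by rewrite -(Num.Theory.eqr_nat rat) -!mcoeff_sum_class eq_sum.
Qed.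

Section Morphism.
Variable sc : shuffle_compatible st.

Let H : shuffle_algebra sc -> hadamard R := malg_ext gk.

Let H_is_monoid_morphism : monoid_morphism H.
Proof.
split=> [|u v].
  by rewrite [LHS]malg_extU gk_class; apply/funext => m; apply: g_cperm0.
rewrite [LHS]malg_ext_comp.
transitivity (malg_ext (fun k => malg_ext (fun l => gk k * gk l) v) u).
  apply: eq_malg_ext => k; rewrite malg_ext_comp; apply: eq_malg_ext => l.
  rewrite -(cclass_repr k) -(cclass_repr l).
  (* Shifting one representative makes the symbols disjoint without changing its class. *)
  rewrite -(cclass_shift sc (symbol_bound (repr k)) (repr l)).
  have dkl := disjoint_shift (repr l) (leqnn (symbol_bound (repr k))).
  by rewrite class_mulE // !gk_class [LHS]malg_ext_shuffles.
rewrite /H /malg_ext big_distrlr /=.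
apply: eq_bigr => k _; rewrite scaler_sumr; apply: eq_bigr => l _.
by rewrite -scalerAl -scalerAr.
Qed.

HB.instance Definition _ := GRing.Linear.copy H (malg_ext gk).
HB.instance Definition _ := GRing.isMonoidMorphism.Build
  (shuffle_algebra sc) (hadamard R) H H_is_monoid_morphism.

Lemma shuffle_algebra_morphism :
  exists F : {lrmorphism shuffle_algebra sc -> hadamard R},
    (forall a, F (shuffle_class sc a) = to_hadamard (g a)) /\ injective F.
Proof.
exists (H : {lrmorphism _ -> _}); split; last exact: malg_ext_inj.
by move=> a; rewrite -gk_class; apply: malg_extU.
Qed.

End Morphism.
End HadamardMorphism.

(** * The generating functions of the theorem: multiplicativity and independence *)

Section GeneratingFunction.
Variable r : nat.
Implicit Types a b c : cperm r.+1.
Local Notation st := (@des_comaj_col r.+1).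
Local Notation x := (xvar r.+1).
Local Notation col := Defs.col.

Lemma genfunE a m :
  genfun a m = pcol a * ppart (@clt r.+1) (zero_letter r) x m a.
Proof.
rewrite -[RHS](fpsCM _ (ppart_series x a)); congr (_ m).
rewrite /genfun -/(qfactor x (size a)).
apply: (canLR (mulrK (qfactor_unit _ _))).
by rewrite -mulrA ppart_seriesM ?cwordP // mulrA fpsC_mul.
Qed.

Lemma genfun_lt_des a m : (m < des a)%N -> genfun a m = 0.
Proof. by move=> lt_m; rewrite /genfun mulrAC fpsMXn lt_m. Qed.

Lemma genfun_des a : genfun a (des a) = pcol a * x ^+ comaj a.
Proof.
rewrite /genfun mulrAC fpsMXn ltnn subnn fpsCM.
by rewrite -/(qfactor x (size a)) qfactor_inv0 mulr1.
Qed.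

Lemma eq_size_col a b : col a = col b -> size a = size b.
Proof.
move=> eq_col; have : perm_eq (colours a) (colours b).
  by apply/allP => j _; have /ffunP/(_ j) := eq_col; rewrite !ffunE /= => ->.
by move/perm_size; rewrite !size_map.
Qed.

Lemma eq_genfun a b : st a = st b -> genfun a = genfun b.
Proof.
by case=> eq_des eq_comaj eq_col; rewrite /genfun /pcol eq_des eq_comaj eq_col
  (eq_size_col eq_col).
Qed.

Lemma pcol_shuffles a b c : c \in shuffles a b -> pcol c = pcol a * pcol b.
Proof.
move=> /mem_shuffles pc; rewrite /pcol -big_split; apply: eq_bigr => j _ /=.
rewrite -exprD !ffunE -count_cat -map_cat; congr (_ ^+ _).
exact/permP/perm_map.
Qed.

Lemma sum_shuffles_genfun a b m : disjoint_symbols a b ->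
  \sum_(c <- shuffles a b) genfun c m = genfun a m * genfun b m.
Proof.
move=> dab; rewrite !genfunE mulrACA -ppart_multiplicative.
- rewrite /shuffle_sum -val_shuffles // big_map big_distrr.
  by apply: eq_big_seq => c cP; rewrite genfunE (pcol_shuffles cP).
- exact: clt_trans.
- exact: clt_asym.
- exact: clt_total.
(* Words with disjoint symbols have disjoint coloured letters. *)
apply/hasPn => y yb; have /hasPn/(_ y.1) := dab.
by rewrite map_f // => /(_ isT); apply: contra => /= ya; rewrite map_f.
Qed.

Lemma des_comaj_col_is_statistic : is_statistic st.
Proof.
move=> a b eq_c [eq_s ord_ab].
have eqD i : (i < size a)%N -> is_descent a i = is_descent b i.
  have colE w j : (nth (zero_letter r) w j).2 = nth ord0 (colours w) j.
    by elim: w j => [|y w IHw] [|j] /=.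
  have symE w j : (nth (zero_letter r) w j).1 = nth 0%N (symbols w) j.
    by elim: w j => [|y w IHw] [|j] /=.
  case: i => [|i] lt_i.
    move: eq_c; rewrite /is_descent.
    by case: (cword a) => [|y w]; case: (cword b) => [|z v] //= [->].
  rewrite /is_descent !(onth_lt (zero_letter r)) -?eq_s ?(ltnW lt_i) //.
  rewrite /clt !colE !symE eq_c.
  by rewrite ord_ab // ltnW.
have eq_Des : Des a = Des b.
  rewrite /Des -eq_s; apply: eq_in_filter => i.
  by rewrite mem_iota add0n => /= /eqD.
by rewrite /des_comaj_col /des /comaj /col eq_Des eq_s eq_c.
Qed.

(** The exponent vector of $\bm p^v x^e$: [insub] fails exactly at the last index, that of $x$. *)
Definition exponent (v : {ffun 'I_r.+1 -> nat}) (e : nat) : multinom r.+2 :=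
  [multinom if insub (val i) is Some j then v j else e | i < r.+2].

Lemma exponent_widen v e j : exponent v e (widen_ord (leqnSn r.+1) j) = v j.
Proof. by rewrite mnmE /= valK. Qed.

Lemma exponent_max v e : exponent v e ord_max = e.
Proof. by rewrite mnmE /= insubF //= ltnn. Qed.

Lemma exponent_inj v e v' e' : exponent v e = exponent v' e' -> v = v' /\ e = e'.
Proof.
move=> eq_m; split; last by rewrite -(exponent_max v e) eq_m exponent_max.
by apply/ffunP => j; rewrite -(exponent_widen v e) eq_m exponent_widen.
Qed.

Lemma pcol_comajE a : pcol a * x ^+ comaj a = 'X_[exponent (col a) (comaj a)].
Proof.
rewrite mpolyXE_id big_ord_recr /= exponent_max; congr (_ * _).
by apply: eq_bigr => j _; rewrite exponent_widen.
Qed.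

(* Triangularity: the lowest term of the image of a class is [t ^ des] times a *)
(* monomial which, for a given [des], determines the class.                    *)
Lemma genfun_free (u : {malg rat[cclass st]}) :
  (forall m, \sum_(k <- msupp u) mcoeff k u *: genfun (repr k) m = 0) -> u = 0.
Proof.
move=> u0; suff coef0 d (k : cclass st) : des (repr k) = d -> mcoeff k u = 0.
  by apply/malgP => k; rewrite (coef0 _ _ erefl) mcoeff0.
elim/ltn_ind: d k => d IHd k des_k.
have [ku|/mcoeff_outdom//] := boolP (k \in msupp u).
pose mk := exponent (col (repr k)) (comaj (repr k)).
have := congr1 (mpoly.mcoeff mk) (u0 d).
rewrite mpoly.mcoeff0 raddf_sum (big_rem k) //= big_seq big1 ?addr0.
  by rewrite -des_k genfun_des pcol_comajE mpoly.mcoeffZ mcoeffX eqxx mulr1.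
move=> l; rewrite mem_rem_uniq ?fset_uniq // inE => /andP[lk _].
(* Classes with larger [des] do not reach $t^d$, those with smaller [des] have coefficient zero by
   induction, and for equal [des] the monomial separates the classes. *)
rewrite mpoly.mcoeffZ; case: (ltngtP d (des (repr l))) => [lt_dl|lt_ld|eq_dl].
- by rewrite genfun_lt_des // mpoly.mcoeff0 mulr0.
- by rewrite (IHd _ lt_ld) // mul0r.
rewrite eq_dl genfun_des pcol_comajE mcoeffX.
case: eqP => [/exponent_inj[eq_col eq_comaj]|_]; last by rewrite mulr0.
case/eqP: lk; apply/eqP; rewrite -(cclass_repr k) -(cclass_repr l).
rewrite cclass_of_eq /st_equiv (eq_size_col eq_col) eqxx /=.
by rewrite /des_comaj_col eq_col eq_comaj des_k eq_dl.
Qed.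

(** The empty word gives $1/(1-t)$, the unit of the Hadamard product. *)
Lemma genfun_cperm0 m : genfun (cperm0 r.+1) m = 1.
Proof.
by rewrite genfunE ppart0 mulr1 /pcol big1 // => j _; rewrite ffunE.
Qed.

End GeneratingFunction.

Theorem theorem4p2 (r : nat) (hr : (1 <= r)%N) :
  shuffle_compatible (@des_comaj_col r) /\
  forall sc : shuffle_compatible (@des_comaj_col r),
  exists H : {lrmorphism shuffle_algebra sc -> hadamard (Qpx r)},
    (forall a : cperm r, H (shuffle_class sc a) = to_hadamard (genfun a)) /\
    injective H.
Proof.
(* Writing the number of colours as a successor provides colour 0, used by [zero_letter]. *)
case: r hr => // r _.
have eq_g (a b : cperm r.+1) : size a = size b ->
  des_comaj_col a = des_comaj_col b -> genfun a = genfun b :> fps (Qpx r.+1).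
  by move=> _; apply: eq_genfun.
split.
  apply: (shuffle_compatible_free eq_g (@sum_shuffles_genfun r)).
    exact: genfun_free.
  exact: des_comaj_col_is_statistic.
move=> sc; exact: (shuffle_algebra_morphism eq_g (@genfun_cperm0 r)
  (@sum_shuffles_genfun r) (@genfun_free r) sc).
Qed.
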